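(* There exists a convex bounded circled set $\mathcal{K}$ in $\mathbb{L}^1[0,1]$ that is compact in $\mathbb{L}^0[0,1]$, such that the $\mathbb{L}^0[0,1]$-topology on $\mathcal{K}$ is locally convex, but there does not exist a probability measure $\mathbb{Q}$ on $[0,1]$, equivalent to the Lebesgue measure, such that the $\mathbb{L}^0(\mathbb{Q})$- and $\mathbb{L}^1(\mathbb{Q})$-topologies agree on $\mathcal{K}$.
   Context: $[0,1]$ carries Lebesgue measure $\mathrm{m}$. $\mathbb{L}^0[0,1]$ is the space of real measurable functions modulo a.e. equality with the topology of convergence in measure (the $\mathbb{L}^0[0,1]$-topology); $\mathbb{L}^1[0,1]$ is the space of Lebesgue integrable functions with its norm, and bounded means norm bounded. A set $\mathcal{K}$ is circled if $\mathcal{K}=-\mathcal{K}$. The (relative) $\mathbb{L}^0$-topology on a convex set $\mathcal{K}$ is locally convex at $X\in\mathcal{K}$ if for every $\mathbb{L}^0$-neighborhood $\mathcal{U}$ of $0$ there is a convex neighborhood $\mathcal{W}$ of $X$ in the relative $\mathbb{L}^0$-topology on $\mathcal{K}$ with $\mathcal{W}\subset (X+\mathcal{U})\cap\mathcal{K}$; it is locally convex on $\mathcal{K}$ if this holds at every $X\in\mathcal{K}$. Two measures are equivalent if they are mutually absolutely continuous. That the $\mathbb{L}^0(\mathbb{Q})$- and $\mathbb{L}^1(\mathbb{Q})$-topologies agree on $\mathcal{K}$ means that $\mathcal{K}\subseteq\mathbb{L}^1(\mathbb{Q})$ and the relative topologies on $\mathcal{K}$ inherited from $\mathbb{L}^0(\mathbb{Q})$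 (convergence in probability) and from the norm of $\mathbb{L}^1(\mathbb{Q})$ coincide. *)

(* Defs.v *)
From HB Require Import structures.
From mathcomp Require Import all_boot all_order all_algebra.
From mathcomp Require Import all_classical all_reals all_analysis measurable_realfun.

Set Implicit Arguments.
Unset Strict Implicit.
Unset Printing Implicit Defensive.

Import Order.TTheory GRing.Theory Num.Theory.
Import numFieldNormedType.Exports.

Local Open Scope classical_set_scope.
Local Open Scope ring_scope.
Local Open Scope quotient_scope.

Section L0.
Context d (T : measurableType d) (R : realType).

(* [R] and [measurableTypeR R] carry the same sigma-algebra under different
   displays: the library states its Lp-spaces with the latter, and puts the
   vector space structure on functions valued in the former. *)
Definition mfun_toR (f : {mfun T >-> measurableTypeR R}) : {mfun T >-> R} :=
  HB.pack (f : T -> R)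
    (@isMeasurableFun.Build d _ T R f (@measurable_funPT _ _ _ _ f)).

Definition mfun_ofR (f : {mfun T >-> R}) : {mfun T >-> measurableTypeR R} :=
  HB.pack (f : T -> measurableTypeR R)
    (@isMeasurableFun.Build d _ T (measurableTypeR R) f
      (@measurable_funPT _ _ _ _ f)).

Variable mu : {measure set T -> \bar R}.

Definition L0 : Type := {mfun_ mu, T >-> measurableTypeR R}.

HB.instance Definition _ := Choice.on L0.
HB.instance Definition _ := EqQuotient.on L0.

Definition L0_fun (X : L0) : {mfun T >-> R} := mfun_toR (repr X).
Coercion L0_fun : L0 >-> MeasurableFun.type.

Definition L0_of (f : {mfun T >-> R}) : L0 := \pi_L0 (mfun_ofR f).

Lemma L0_eqP (X Y : L0) : X = Y <-> (X : T -> R) = Y %[ae mu].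
Proof.
split=> [->|XY]; first exact: ae_eq_refl.
by rewrite -[X]reprK -[Y]reprK; apply/eqmodP; exact/asboolP.
Qed.

Lemma L0_ofE (f : {mfun T >-> R}) : (L0_of f : T -> R) = f %[ae mu].
Proof.
have : repr (L0_of f) = mfun_ofR f %[mod L0] by rewrite reprK.
by move/eqmodP => /asboolP.
Qed.

End L0.

Section L0_lmodType.
Context d (T : measurableType d) (R : realType).
Variable mu : {measure set T -> \bar R}.
Local Notation L0 := (L0 mu).
Implicit Types X Y Z : L0.

Let zero : L0 := L0_of mu 0.
Let opp X : L0 := L0_of mu (- (X : {mfun T >-> R})).
Let add X Y : L0 := L0_of mu ((X : {mfun T >-> R}) + Y).
Let scale (a : R) X : L0 := L0_of mu (a *: (X : {mfun T >-> R})).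

Let zeroE : (zero : T -> R) = cst 0 %[ae mu].
Proof. exact: L0_ofE. Qed.

Let oppE X : (opp X : T -> R) = \- X %[ae mu].
Proof. exact: L0_ofE. Qed.

Let addE X Y : (add X Y : T -> R) = X \+ Y %[ae mu].
Proof. exact: L0_ofE. Qed.

Let scaleE a X : (scale a X : T -> R) = a \*: (X : T -> R) %[ae mu].
Proof. exact: L0_ofE. Qed.

Let addA : associative add.
Proof.
move=> X Y Z; apply/L0_eqP.
have /(filterI (addE Y Z)) h1 := addE X (add Y Z).
have /(filterI (addE X Y)) h2 := addE (add X Y) Z.
move: h1 h2; apply: filterS2 => x [h1 h2] [h3 h4] xT.
by rewrite h2// h4//= h1// h3//= addrA.
Qed.

Let addC : commutative add.
Proof.
move=> X Y; apply/L0_eqP; have := addE X Y; have := addE Y X.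
by apply: filterS2 => x h1 h2 xT; rewrite h1// h2//= addrC.
Qed.

Let add0 : left_id zero add.
Proof.
move=> X; apply/L0_eqP; have := addE zero X; have := zeroE.
by apply: filterS2 => x h1 h2 xT; rewrite h2//= h1// add0r.
Qed.

Let addN : left_inverse zero opp add.
Proof.
move=> X; apply/L0_eqP.
have := addE (opp X) X; have := oppE X; have := zeroE.
by apply: filterS3 => x h1 h2 h3 xT; rewrite h3//= h2//= h1// addNr.
Qed.

HB.instance Definition _ := GRing.isZmodule.Build L0 addA addC add0 addN.

Let scaleA a b X : scale a (scale b X) = scale (a * b) X.
Proof.
apply/L0_eqP.
have := scaleE a (scale b X); have := scaleE b X; have := scaleE (a * b) X.
by apply: filterS3 => x h1 h2 h3 xT; rewrite h1// h3//= h2//= scalerA.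
Qed.

Let scale1 : left_id 1 scale.
Proof.
move=> X; apply/L0_eqP; have := scaleE 1 X.
by apply: filterS => x h xT; rewrite h//= scale1r.
Qed.

Let scaleDr : right_distributive scale +%R.
Proof.
move=> a X Y; apply/L0_eqP.
have /(filterI (addE X Y)) h1 := scaleE a (X + Y).
have /(filterI (scaleE a X)) h2 := scaleE a Y.
have h3 := addE (scale a X) (scale a Y); move: h1 h2 h3.
apply: filterS3 => x [h1 h2] [h3 h4] h5 xT.
by rewrite h2//= h1// h5//= h3// h4//= scalerDr.
Qed.

Let scaleDl X : {morph scale^~ X : a b / a + b}.
Proof.
move=> a b; apply/L0_eqP.
have := scaleE (a + b) X; have := addE (scale a X) (scale b X).
have /(filterI (scaleE a X)) := scaleE b X.
apply: filterS3 => x [h1 h2] h3 h4 xT.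
by rewrite h4// h3//= h1// h2//= scalerDl.
Qed.

HB.instance Definition _ :=
  GRing.Zmodule_isLmodule.Build R L0 scaleA scale1 scaleDr scaleDl.

Lemma L0_0E : ((0 : L0) : T -> R) = cst 0 %[ae mu].
Proof. exact: zeroE. Qed.

Lemma L0_oppE X : ((- X : L0) : T -> R) = \- X %[ae mu].
Proof. exact: oppE. Qed.

Lemma L0_addE X Y : ((X + Y : L0) : T -> R) = X \+ Y %[ae mu].
Proof. exact: addE. Qed.

Lemma L0_scaleE a X : ((a *: X : L0) : T -> R) = a \*: (X : T -> R) %[ae mu].
Proof. exact: scaleE. Qed.

End L0_lmodType.

Section L0_topology.
Context d (T : measurableType d) (R : realType).
Variable mu : {measure set T -> \bar R}.
Local Notation L0 := (L0 mu).
Implicit Types X Y Z : L0.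

(* The topology of convergence in measure. *)
Definition L0_ball X (e : R) Y : Prop :=
  (mu [set x | (e <= `|X x - Y x|)%R] < e%:E)%E.

Let measurable_dist X Y (e : R) : measurable [set x | e <= `|X x - Y x|].
Proof.
have mf : measurable_fun setT (fun x => `|X x - Y x|).
  by apply: measurableT_comp => //; exact: measurable_funB.
rewrite -[X in measurable X]setTI.
rewrite (_ : [set _ | _] = (fun x => `|X x - Y x|) @^-1` `[e, +oo[).
  by apply: mf => //; exact: measurable_itv.
by apply/seteqP; split => x /=; rewrite in_itv/= andbT.
Qed.

Let ball_center X (e : R) : 0 < e -> L0_ball X e X.
Proof.
move=> e0; rewrite /L0_ball (_ : [set _ | _] = set0) ?measure0 ?lte_fin//.
by apply/seteqP; split => x //=; rewrite subrr normr0 leNgt e0.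
Qed.

Let ball_sym X Y (e : R) : L0_ball X e Y -> L0_ball Y e X.
Proof. by rewrite /L0_ball; under eq_set do rewrite distrC. Qed.

Let ball_triangle X Y Z (e1 e2 : R) :
  L0_ball X e1 Y -> L0_ball Y e2 Z -> L0_ball X (e1 + e2) Z.
Proof.
rewrite /L0_ball => XY YZ; rewrite EFinD.
apply: le_lt_trans (lteD XY YZ).
apply: le_trans (measureU2 _ (measurable_dist X Y e1) (measurable_dist Y Z e2)).
apply: le_measure; rewrite ?inE//; first by apply: measurableU.
move=> x /= e12; have [|Xe] := leP e1 `|X x - Y x|; first by left.
right; rewrite leNgt; apply/negP => Ye.
have := ler_distD (Y x) (X x) (Z x); rewrite leNgt => /negP; apply.
exact: lt_le_trans (ltrD Xe Ye) e12.
Qed.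

HB.instance Definition _ := hasNbhs.Build L0 (nbhs_ (entourage_ L0_ball)).

HB.instance Definition _ := @Nbhs_isPseudoMetric.Build R L0
  (entourage_ L0_ball) erefl L0_ball ball_center ball_sym ball_triangle erefl.

End L0_topology.

Section L1_topology.
Context d (T : measurableType d) (R : realType).
Variable mu : {measure set T -> \bar R}.

Definition L1 : Type := LspaceType1 mu.

HB.instance Definition _ := gen_eqMixin L1.
HB.instance Definition _ := gen_choiceMixin L1.

Definition L1_to_L0 (f : L1) : L0 mu := LebesgueSpace.sort f.
Coercion L1_to_L0 : L1 >-> L0.

Implicit Types f g h : L1.

Definition L1_ball f (e : R) g : Prop := ('N[mu]_1[EFin \o (f \- g)%R] < e%:E)%E.

Let ball_center f (e : R) : 0 < e -> L1_ball f e f.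
Proof.
move=> e0; rewrite /L1_ball (_ : EFin \o _ = cst 0%E) ?Lnorm0 ?lte_fin//.
by apply/funext => x /=; rewrite subrr.
Qed.

Let ball_sym f g (e : R) : L1_ball f e g -> L1_ball g e f.
Proof.
rewrite /L1_ball; suff -> : EFin \o (g \- f)%R = (\- (EFin \o (f \- g)%R))%E.
  by rewrite oppe_Lnorm.
by apply/funext => x /=; rewrite -[RHS]EFinN opprB.
Qed.

Let ball_triangle f g h (e1 e2 : R) :
  L1_ball f e1 g -> L1_ball g e2 h -> L1_ball f (e1 + e2) h.
Proof.
rewrite /L1_ball => fg gh; rewrite EFinD; apply: le_lt_trans (lteD fg gh).
rewrite (_ : EFin \o (f \- h)%R = EFin \o ((f \- g) \+ (g \- h))%R); last first.
  by apply/funext => x /=; rewrite addrA subrK.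
by apply: eminkowski => //; exact: measurable_funB.
Qed.

HB.instance Definition _ := hasNbhs.Build L1 (nbhs_ (entourage_ L1_ball)).

HB.instance Definition _ := @Nbhs_isPseudoMetric.Build R L1
  (entourage_ L1_ball) erefl L1_ball ball_center ball_sym ball_triangle erefl.

End L1_topology.

Section L0_subsets.
Context d (T : measurableType d) (R : realType).
Variable mu : {measure set T -> \bar R}.
Implicit Types (K W U : set (L0 mu)) (X : L0 mu).

Definition convex K := @convex_set R (L0 mu) K.

Definition circled K := K = -%R @` K.

Definition L1_bounded K :=
  K `<=` range (@L1_to_L0 _ _ _ mu) /\
  exists M : R, forall X, K X -> ('N[mu]_1[EFin \o X] <= M%:E)%E.

(* [within K (nbhs X) W] makes [W] a neighborhood of [X] in the relative
   topology once [W `<=` K], which the last conjunct imposes. *)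
Definition locally_convex_at K X :=
  forall U, nbhs (0 : L0 mu) U ->
  exists W, [/\ convex W, within K (nbhs X) W & W `<=` (+%R X @` U) `&` K].

Definition locally_convex_on K := forall X, K X -> locally_convex_at K X.

Definition L0_L1_topologies_agree K :=
  K `<=` range (@L1_to_L0 _ _ _ mu) /\
  forall W,
    (exists2 U : set (L0 mu), open U & W = U `&` K) <->
    (exists2 V : set (L1 mu), open V & W = (@L1_to_L0 _ _ _ mu @` V) `&` K).

End L0_subsets.

Section change_of_measure.
Context d (T : measurableType d) (R : realType).

Definition equivalent (mu nu : {measure set T -> \bar R}) :=
  mu `<< nu /\ nu `<< mu.

(* For equivalent [mu] and [nu] this is the identification of the two spaces
   L0(mu) and L0(nu), which have the same almost-everywhere classes. *)
Definition L0_cast (mu nu : {measure set T -> \bar R}) (X : L0 mu) : L0 nu :=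
  L0_of nu X.

Lemma L0_cast_of (mu nu : {measure set T -> \bar R}) (f : {mfun T >-> R}) :
  nu `<< mu -> L0_cast nu (L0_of mu f) = L0_of nu f.
Proof.
move=> numu; apply/L0_eqP; apply: ae_eq_trans (ae_eq_sym (L0_ofE nu f)).
apply: ae_eq_trans (L0_ofE nu _) _.
exact: (null_dominates_ae_eq _ numu (L0_ofE mu f)).
Qed.

Lemma L0_castK (mu nu : {measure set T -> \bar R}) :
  mu `<< nu -> cancel (@L0_cast mu nu) (@L0_cast nu mu).
Proof.
move=> munu X; rewrite {2}/L0_cast L0_cast_of//.
by apply/L0_eqP; exact: L0_ofE.
Qed.

End change_of_measure.

(* The unit interval is modelled by the Borel line carrying Lebesgue measure
   restricted to [0, 1]; a probability measure on the line equivalent to it is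
   concentrated on [0, 1]. Borel functions and Lebesgue-measurable functions
   have the same almost-everywhere classes. *)
Definition lebesgue01 (R : realType) : {measure set (measurableTypeR R) -> \bar R} :=
  mrestr lebesgue_measure (measurable_itv `[0%R : R, 1%R]).

(* Main.v *)
(* For n in the block [2^L, 2^(L+1)), let [osc n] be the function on [0, 1] whose
   sign is the (n+1)-st binary digit and whose modulus is the step function
   2^L / ((j+1) H_(2^L)), j < 2^L, shifted cyclically by n. Each [osc n] has L1
   norm 1 but weak-L1 norm at most 1 / H_(2^L), which tends to 0. Truncating and using
   the orthogonality given by the signs, sums [sum_n d n * osc n] with
   [sum_n |d n| <= 1] obey the same weak-type bound, so [a |-> sum_n a n * osc n]
   is continuous from the unit ball of l1, with the topology of coordinatewise
   convergence, to L0. Its image K is convex, circled, compact and bounded in L1,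
   and it inherits local convexity from the ball. On the other hand the moduli of
   the [osc n] in a block average to the constant 1, so for every probability Q
   each block contains some [osc n] with L1(Q) norm > 1/2, while [osc n] tends to
   0 in L0. *)
From HB Require Import structures.
Require Import Defs.
From mathcomp Require Import all_boot all_order all_algebra.
From mathcomp Require Import all_classical all_reals all_analysis.
From mathcomp Require Import measurable_realfun ring lra zify.

Set Implicit Arguments.
Unset Strict Implicit.
Unset Printing Implicit Defensive.

Import Order.TTheory GRing.Theory Num.Theory.
Import numFieldNormedType.Exports.

Local Open Scope classical_set_scope.
Local Open Scope ring_scope.

(** * Convergence in measure *)

Section measure_lemmas.
Context d (T : measurableType d) (R : realType).
Variable mu : {measure set T -> \bar R}.

Lemma ae_le_measure (A B : set T) : measurable A -> measurable B ->
  {ae mu, forall x, A x -> B x} -> (mu A <= mu B)%E.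
Proof.
move=> mA mB [N [mN N0 AB]].
apply: (@le_trans _ _ (mu (B `|` N))).
  apply: le_measure; rewrite ?inE//; first exact: measurableU.
  move=> x Ax; have [Bx|Bx] := pselect (B x); first by left.
  by right; apply: AB => /= /(_ Ax).
by apply: le_trans (measureU2 _ mB mN) _; rewrite [X in (_ + X)%E]N0 adde0.
Qed.

Lemma measurable_ge (f : T -> R) (e : R) : measurable_fun setT f ->
  measurable [set x | e <= `|f x|].
Proof.
move=> mf; have m : measurable_fun setT (fun x => `|f x|).
  exact: measurableT_comp.
rewrite -[X in measurable X]setTI.
rewrite (_ : [set _ | _] = (fun x => `|f x|) @^-1` `[e, +oo[).
  by apply: m => //; exact: measurable_itv.
by apply/seteqP; split => x /=; rewrite in_itv/= andbT.
Qed.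

Lemma markov_ineq (f : T -> R) (e : R) : 0 < e -> measurable_fun setT f ->
  (mu [set x | (e <= `|f x|)%R] <= e^-1%:E * \int[mu]_x `|f x|%:E)%E.
Proof.
move=> e0 mf; rewrite lee_pdivlMl//.
have mfE : measurable_fun setT (EFin \o f) by exact/measurable_EFinP.
have := le_integral_comp_abse mu measurableT (@measurable_id _ _ setT) _ _ mfE e0.
rewrite setTI; apply => //.
Qed.

Lemma measurable_L0B (X Y : L0 mu) : measurable_fun setT (fun x => X x - Y x).
Proof. exact: measurable_funB. Qed.

(** Lowering the threshold to [min e r] enlarges the set while its measure stays below [r], so each
    set [e <= |X - Y|] is null. The thresholds [1 / (k + 1)] exhaust the set where [X] and [Y]
    differ. *)
Lemma L0_eq_small (X Y : L0 mu) :
  (forall e : R, 0 < e -> (mu [set x | (e <= `|X x - Y x|)%R] < e%:E)%E) -> X = Y.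
Proof.
move=> small.
have null (e : R) : 0 < e -> mu [set x | e <= `|X x - Y x|] = 0%E.
  move=> e0; apply/eqP; rewrite eq_le measure_ge0 andbT.
  apply/lee_addgt0Pr => r r0; rewrite add0e.
  have m0 : 0 < Num.min e r by rewrite lt_min e0.
  apply: (@le_trans _ _ (mu [set x | Num.min e r <= `|X x - Y x|])).
    apply: le_measure; rewrite ?inE; [exact/measurable_ge/measurable_L0B..|].
    by move=> x /=; apply: le_trans; rewrite ge_min lexx.
  by apply: le_trans (ltW (small _ m0)) _; rewrite lee_fin ge_min lexx orbT.
apply/L0_eqP; apply: (@negligibleS _ _ _ mu
    (\bigcup_k [set x | (k.+1%:R^-1 : R) <= `|X x - Y x|])).
  move=> x /= /not_implyP[_ /eqP]; rewrite -subr_eq0 -normr_gt0 => h.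
  exists (Num.truncn (`|X x - Y x|^-1)) => //=.
  by rewrite invf_ple ?posrE//; exact/ltW/truncnS_gt.
apply: negligible_bigcup => k; exists [set x | (k.+1%:R^-1 : R) <= `|X x - Y x|].
by split => //; [exact/measurable_ge/measurable_L0B|exact: null].
Qed.

Lemma L0_hausdorff : hausdorff_space (L0 mu).
Proof.
rewrite ball_hausdorff => X Y XY; apply: contrapT => nb; case/eqP: XY.
apply: L0_eq_small => e e0; have e20 : 0 < e / 2 by rewrite divr_gt0.
have /set0P[Z [XZ YZ]] : ball X (e / 2) `&` ball Y (e / 2) != set0.
  by apply/negP => b0; apply: nb; exists (PosNum e20, PosNum e20).
by have := ball_triangle XZ (ball_sym YZ); rewrite -splitr.
Qed.

(** The epsilon-delta form of absolute continuity, which turns smallness in Lebesgue measure into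
    smallness under [Q]. *)
Lemma finite_measure_continuous (nu : {finite_measure set T -> \bar R}) (e : R) :
  nu `<< mu -> 0 < e -> exists2 del : R, 0 < del &
    forall A, measurable A -> (mu A < del%:E)%E -> (nu A < e%:E)%E.
Proof.
move=> numu e0; pose c := charge_of_finite_measure nu.
have [P [N PN]] := Hahn_decomposition c.
have cmu : c `<< mu by [].
have [del [del0 h]] := charge_variation_continuous PN cmu e0.
exists del => // A mA /(h _ mA); apply: le_lt_trans.
apply: le_trans (abse_charge_variation PN mA).
exact: lee_abs.
Qed.

End measure_lemmas.


(** * Averages over dyadic cells *)

Section dyadic_means.
Context {R : realType}.
Implicit Types (h : nat -> R) (w : nat -> nat -> R) (N L : nat).

Definition mean N h : R := (\sum_(0 <= i < 2 ^ N) h i) / (2 ^ N)%:R.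

Lemma pow2_gt0 N : 0 < (2 ^ N)%:R :> R.
Proof. by rewrite ltr0n expn_gt0. Qed.

Lemma eq_mean N h1 h2 : (forall i, (i < 2 ^ N)%N -> h1 i = h2 i) ->
  mean N h1 = mean N h2.
Proof.
by move=> h12; rewrite /mean; congr (_ / _); apply: eq_big_nat => i /andP[_ /h12].
Qed.

Lemma le_mean N h1 h2 : (forall i, (i < 2 ^ N)%N -> h1 i <= h2 i) ->
  mean N h1 <= mean N h2.
Proof.
move=> h12; rewrite /mean ler_pM2r ?invr_gt0 ?pow2_gt0//.
by apply: ler_sum_nat => i /andP[_ /h12].
Qed.

Lemma meanD N h1 h2 : mean N (fun i => h1 i + h2 i) = mean N h1 + mean N h2.
Proof. by rewrite /mean big_split mulrDl. Qed.

Lemma meanZ N c h : mean N (fun i => c * h i) = c * mean N h.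
Proof. by rewrite /mean -mulr_sumr mulrA. Qed.

Lemma sum_double M h :
  \sum_(0 <= i < M.*2) h i = \sum_(0 <= i < M) (h i.*2 + h i.*2.+1).
Proof.
elim: M => [|M IH]; first by rewrite !big_geq.
by rewrite doubleS !big_nat_recr//= IH addrA.
Qed.

Lemma mean_double N h :
  mean N.+1 h = mean N (fun i => (h i.*2 + h i.*2.+1) / 2).
Proof.
rewrite /mean expnS mul2n sum_double -mulr_suml -mulrA; congr (_ * _).
by rewrite -mul2n natrM invfM.
Qed.

(** A dyadic martingale written on cell indices: [J] is a cell at level [N], [J./2] its parent, and
    the last binary digit of [J] gives the sign of the last increment. *)
Fixpoint walk w N (J : nat) : R :=
  if N is n.+1 then walk w n J./2 + (-1) ^+ J * w n J./2 else 0.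

(* Averaging over the last binary digit of J kills the cross term between the
   walk at time n and its next increment. *)
Lemma mean_walk_sqr w N :
  mean N (fun J => walk w N J ^+ 2) =
  \sum_(0 <= n < N) mean n (fun I => w n I ^+ 2).
Proof.
elim: N => [|N IH].
  by rewrite [RHS]big_geq// /mean big_nat1 /= expr0n mul0r.
rewrite big_nat_recr//= -IH -meanD mean_double; apply: eq_mean => i _.
have e2 : (-1) ^+ i.*2 = 1 :> R by rewrite -signr_odd odd_double.
rewrite /= doubleK uphalf_double [(-1) ^+ i.*2.+1]exprS e2.
by field.
Qed.

(** Raising the shift by one drops the first term and appends its copy one period later. *)
Lemma sum_periodic (k : nat) (f : nat -> R) (s : nat) :
  (forall i, f (i + k)%N = f i) ->
  \sum_(0 <= i < k) f (i + s)%N = \sum_(0 <= i < k) f i.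
Proof.
move=> per; elim: s => [|s IH]; first by under eq_bigr do rewrite addn0.
case: k per IH => [|k] per IH; first by rewrite !big_geq.
rewrite -IH big_nat_recr//= [RHS]big_nat_recl//= addrC; congr (_ + _).
  by rewrite add0n -(per s); congr f; rewrite addnC -addSnnS.
by apply: eq_bigr => i _; rewrite addnS addSn.
Qed.

Lemma sum_divn (M k : nat) h : (0 < M)%N ->
  \sum_(0 <= i < k * M) h (i %/ M)%N = M%:R * \sum_(0 <= i < k) h i.
Proof.
move=> M0; elim: k => [|k IH]; first by rewrite mul0n !big_geq ?mulr0.
rewrite mulSnr (big_cat_nat (leq0n _) (leq_addr _ _))//= IH big_nat_recr//= mulrDr.
congr (_ + _); rewrite -{1}[(k * M)%N]add0n big_addn addKn.
rewrite (eq_big_nat _ _ (F2 := fun=> h k)); last first.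
  by move=> i /andP[_ iM]; rewrite addnC divnMDl// divn_small// addn0.
by rewrite sumr_const_nat subn0 mulr_natl.
Qed.

(** * Harmonic sums and the distribution of a spike *)

Definition harm (k : nat) : R := \sum_(0 <= j < k) (j.+1)%:R^-1.

(** Oresme's argument: doubling the range from [2^L] adds [2^L] terms, each at least
    [1 / 2^(L+1)]. *)
Lemma harm_pow2_ge L : L%:R / 2 <= harm (2 ^ L).
Proof.
elim: L => [|L IH].
  by rewrite mul0r /harm big_nat1 invr1.
rewrite expnS mul2n -addnn /harm (big_cat_nat (leq0n _) (leq_addr _ _))//=.
rewrite -[X in X <= _]/(L.+1%:R / 2) -natr1 mulrDl lerD//.
rewrite -{1}[(2 ^ L)%N]add0n big_addn addKn.
apply: (@le_trans _ _ (\sum_(0 <= i < 2 ^ L) (2 ^ L + 2 ^ L)%:R^-1)).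
  rewrite sumr_const_nat subn0 -[leRHS]mulr_natr natrD.
  by rewrite le_eqVlt; apply/orP; left; apply/eqP; field.
apply: ler_sum_nat => i /andP[_ i2]; rewrite lef_pV2 ?posrE ?ltr0n//.
  by rewrite ler_nat -addSn leq_add2r.
by rewrite addn_gt0 expn_gt0.
Qed.

Lemma harm_ge1 k : (0 < k)%N -> 1 <= harm k.
Proof.
case: k => // k _; rewrite /harm big_nat_recl// invr1 lerDl.
by apply: sumr_ge0.
Qed.

Lemma harm_nondecreasing : {homo harm : m n / (m <= n)%N >-> m <= n}.
Proof.
move=> m n mn; rewrite /harm [leRHS](big_cat_nat (leq0n _) mn)//= lerDl.
by apply: sumr_ge0.
Qed.

(* Heights of a spike over 2^L equal cells: mean 1, and weak-L1 norm at most
   1 / harm (2 ^ L) by spike_ge_tail. *)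
Definition spike L (j : nat) : R := (2 ^ L)%:R / ((j.+1)%:R * harm (2 ^ L)).

Let H L := harm (2 ^ L).

Let H_gt0 L : 0 < H L.
Proof. by rewrite (lt_le_trans ltr01)// harm_ge1// expn_gt0. Qed.

Lemma spike_gt0 L j : 0 < spike L j.
Proof. by rewrite divr_gt0 ?pow2_gt0// mulr_gt0 ?H_gt0. Qed.

Lemma mean_spike L : mean L (spike L) = 1.
Proof.
rewrite /mean /spike; under eq_bigr do rewrite invfM.
rewrite -mulr_sumr -mulr_suml mulrAC divff ?gt_eqF ?pow2_gt0// mul1r.
by rewrite divff// gt_eqF// H_gt0.
Qed.

Lemma count_le (y : R) (k : nat) : 0 <= y ->
  \sum_(0 <= j < k) ((j.+1)%:R <= y)%R%:R <= y.
Proof.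
move=> y0; elim: k => [|k IH]; first by rewrite big_geq.
rewrite big_nat_recr//=; have [ky|ky] := leP k.+1%:R y; last by rewrite /= addr0.
apply: le_trans ky; rewrite -[leRHS]natr1 lerD2r.
apply: (@le_trans _ _ (\sum_(0 <= j < k) 1)).
  by apply: ler_sum => j _; rewrite lern1 leq_b1.
by rewrite sumr_const_nat subn0.
Qed.

(** The height is proportional to [1 / (j + 1)], so it reaches [s] exactly when
    [j + 1 <= 2^L / (s H)], and at most that many [j] qualify. *)
Lemma spike_ge_tail L (s : R) : 0 < s ->
  mean L (fun j => (s <= spike L j)%R%:R) <= (s * H L)^-1.
Proof.
move=> s0; rewrite /mean ler_pdivrMr ?pow2_gt0//.
apply: le_trans (@count_le ((s * H L)^-1 * (2 ^ L)%:R) (2 ^ L)%N _); last first.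
  by rewrite mulr_ge0 ?invr_ge0 ?mulr_ge0 ?ltW.
apply: ler_sum => j _; suff -> : (s <= spike L j) =
  (j.+1%:R <= (s * H L)^-1 * (2 ^ L)%:R) by [].
rewrite /spike ler_pdivlMr; last by rewrite mulr_gt0 ?H_gt0.
rewrite [_^-1 * _]mulrC ler_pdivlMr; last by rewrite mulr_gt0 ?H_gt0.
by rewrite mulrCA.
Qed.

Lemma sum_inv_sqr_le (y : R) (k : nat) : 0 < y ->
  \sum_(0 <= j < k) (y < (j.+1)%:R)%R%:R * (j.+1)%:R^-2 <= 2 / y.
Proof.
move=> y0.
pose A m : R := \sum_(0 <= j < m) (y < (j.+1)%:R)%R%:R * (j.+1)%:R^-2.
rewrite -/(A k).
(* Strengthened for the induction: with [- 1/k] the bound telescopes, as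
   [1 / (k+1)^2 <= 1/k - 1/(k+1)]. The factor 2 pays for the first surviving term. *)
suff [A0 A1] : (k%:R <= y -> A k = 0) /\
               (y < k%:R -> A k <= 2 / y - k%:R^-1).
  have [/A0 ->|yk] := leP k%:R y; first by rewrite divr_ge0 ?ltW.
  by apply: le_trans (A1 yk) _; rewrite gerBl invr_ge0.
elim: k => [|k [IH0 IH1]].
  split=> [_|]; first by rewrite /A big_geq.
  by move=> y0'; have := lt_trans y0 y0'; rewrite ltxx.
rewrite /A big_nat_recr//= -/(A k); split=> [ky|yk].
  rewrite ltNge ky mul0r addr0 IH0//.
  by apply: le_trans ky; rewrite ler_nat.
rewrite yk mul1r; have k1 : 0 < k.+1%:R :> R by [].
have [ky|ky] := leP k%:R y.
  rewrite IH0// add0r lerBrDr.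
  have y1 : k.+1%:R^-1 <= y^-1 by rewrite lef_pV2 ?posrE// ltW.
  have : k.+1%:R^-2 <= k.+1%:R^-1 :> R.
    by rewrite lef_pV2 ?posrE ?exprn_gt0// expr2 ler_peMl// ler1n.
  by move=> h; rewrite mulr_natl mulr2n lerD// (le_trans h).
have k0 : 0 < k%:R :> R by exact: lt_trans y0 ky.
apply: le_trans (lerD (IH1 ky) (lexx _)) _.
rewrite -addrA lerD2l -lerBrDl.
have -> : - k.+1%:R^-1 - - k%:R^-1 = (k%:R * k.+1%:R)^-1 :> R.
  by rewrite -natr1 in k1 *; field; rewrite !gt_eqF.
rewrite lef_pV2 ?posrE ?exprn_gt0 ?mulr_gt0// expr2.
by rewrite ler_pM2r// ler_nat.
Qed.

(** Truncation below [s] keeps the indices [j + 1 > y] with [y = 2^L / (s H)], so the sum is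
    [(2^L / H)^2] times a tail of the inverse squares, which is at most [2 / y]. *)
Lemma spike_truncated_sqr L (s : R) : 0 < s ->
  mean L (fun j => (spike L j < s)%R%:R * spike L j ^+ 2) <= 2 * s / H L.
Proof.
move=> s0; rewrite /mean ler_pdivrMr ?pow2_gt0//.
set y := (2 ^ L)%:R / (s * H L).
have y0 : 0 < y by rewrite divr_gt0 ?pow2_gt0// mulr_gt0 ?H_gt0.
have -> : 2 * s / H L * (2 ^ L)%:R = ((2 ^ L)%:R / H L) ^+ 2 * (2 / y).
  by rewrite /y; field; rewrite !gt_eqF ?pow2_gt0 ?H_gt0.
apply: le_trans (ler_wpM2l _ (@sum_inv_sqr_le y (2 ^ L)%N y0)); last first.
  by rewrite sqr_ge0.
rewrite mulr_sumr; apply: ler_sum => j _.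
have -> : (spike L j < s) = (y < j.+1%:R).
  rewrite /spike /y ltr_pdivrMr ?mulr_gt0 ?H_gt0//.
  by rewrite ltr_pdivrMr ?mulr_gt0 ?H_gt0// mulrCA.
rewrite [leRHS]mulrCA ler_wpM2l// /spike le_eqVlt; apply/orP; left; apply/eqP.
by rewrite -/(H L); field; rewrite addrC natr1 pnatr_eq0/= gt_eqF.
Qed.

(** Since [trunc_log 2 0 = 0], the index 0 shares level 0 with the index 1. *)
Definition level (n : nat) : nat := trunc_log 2 n.

(* The first [level n] of the n binary digits of I select a cell. *)
Definition amp (n I : nat) : R :=
  spike (level n) ((I %/ 2 ^ (n - level n) + n) %% 2 ^ level n).

Lemma level_le n : (level n <= n)%N.
Proof.
case: n => [|n] //; rewrite /level.
have /andP[+ _] := @trunc_log_bounds 2 n.+1 isT isT.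
by move=> /(leq_trans (ltn_expl (trunc_log 2 n.+1) (isT : 1 < 2)%N)) /ltnW.
Qed.

(** Division by [2^(n - L)] repeats each cell of level [L] equally often, and the cyclic shift by
    [n] only permutes these cells. So [amp n] and [spike L] have the same distribution. *)
Lemma mean_amp n (phi : R -> R) :
  mean n (fun I => phi (amp n I)) = mean (level n) (fun j => phi (spike (level n) j)).
Proof.
rewrite /mean; set L := level n.
have nE : (2 ^ n = 2 ^ L * 2 ^ (n - L))%N by rewrite -expnD subnKC// level_le.
rewrite {1}nE.
rewrite (sum_divn (2 ^ L) (fun i => phi (spike L ((i + n) %% 2 ^ L)))) ?expn_gt0//.
rewrite (sum_periodic (f := fun i => phi (spike L (i %% 2 ^ L)))); last first.
  by move=> i; rewrite modnDr.
rewrite nE mulnC natrM invfM mulrACA divff ?gt_eqF ?pow2_gt0// ?mul1r.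
congr (_ / _); apply: eq_big_nat => i /andP[_ iL].
by rewrite modn_small.
Qed.

End dyadic_means.

(** * The oscillating spikes *)

Section cells.
Context {R : realType}.
Local Notation mu := (lebesgue01 R).
Local Notation T := (measurableTypeR R).
Implicit Types (N : nat) (x : T) (h : nat -> R).

(** The index of a dyadic interval for points of [[0, 1)]. Elsewhere, on a null set of [lebesgue01],
    it is 0 to the left of 0 and at least [2^N] from 1 on. *)
Definition cell N (x : T) : nat := Num.truncn ((2 ^ N)%:R * (x : R)).

Lemma cell_half N x : (cell N.+1 x)./2 = cell N x.
Proof.
rewrite /cell expnS natrM -mulrA; set y := _ * (x : R).
(* For negative [y] both truncations take the default value 0. *)
have [y0|y0] := leP 0 y; last first.
  have -> : Num.truncn (2 * y) = 0%N by apply/truncn0Pn; rewrite -ltNge; lra.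
  by have -> : Num.truncn y = 0%N by apply/truncn0Pn; rewrite -ltNge; lra.
have := truncn_itv y0; have : 0 <= 2 * y by lra.
move=> /truncn_itv; move: (Num.truncn _) (Num.truncn y) => a b /andP[a1 a2] /andP[b1 b2].
have : a%:R < (b.+1 * 2)%:R :> R by rewrite natrM; lra.
have : (b * 2)%:R < a.+1%:R :> R by rewrite natrM; lra.
by rewrite !ltr_nat; lia.
Qed.

Lemma cell_div N k x : (cell (N + k) x %/ 2 ^ k)%N = cell N x.
Proof.
elim: k => [|k IH]; first by rewrite addn0 divn1.
by rewrite addnS expnS divnMA divn2 cell_half.
Qed.

Lemma measurable_cell N (A : set nat) : measurable (cell N @^-1` A).
Proof.
have mlt n : measurable [set x : T | (n < cell N x)%N].
  rewrite (_ : [set _ | _] = `[n.+1%:R / (2 ^ N)%:R, +oo[%classic).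
    exact: measurable_itv.
  apply/seteqP; split => x /=; rewrite in_itv/= andbT /cell truncn_gt_nat;
    by rewrite ler_pdivrMr ?pow2_gt0// mulrC.
rewrite (_ : _ @^-1` _ = \bigcup_(i in A) [set x | cell N x = i]); last first.
  apply/seteqP; split => [x Ax|x [i Ai /= ci]]; last by rewrite /preimage/= ci.
  by exists (cell N x).
apply: bigcup_measurable => -[|i] _.
  rewrite (_ : [set _ | _] = ~` [set x | (0 < cell N x)%N]).
    exact: measurableC.
  by apply/seteqP; split => x /=; lia.
rewrite (_ : [set _ | _] =
    [set x | (i < cell N x)%N] `\` [set x | (i.+1 < cell N x)%N]).
  exact: measurableD.
by apply/seteqP; split => x /=; lia.
Qed.

Lemma measurable_fun_cell N h (D : set T) : measurable_fun D (h \o cell N).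
Proof.
apply: (@measurable_funS _ _ _ _ setT) => //.
by move=> _ Y mY; rewrite setTI comp_preimage; exact: measurable_cell.
Qed.

Lemma lebesgue01_cell N i : (i < 2 ^ N)%N ->
  mu [set x | cell N x = i] = ((2 ^ N)%:R^-1)%:E.
Proof.
move=> iN; rewrite /lebesgue01/= /mrestr.
have p0 := @pow2_gt0 R N.
rewrite (_ : _ `&` _ = `[i%:R / (2 ^ N)%:R, i.+1%:R / (2 ^ N)%:R[%classic).
  rewrite lebesgue_measure_itv/= lte_fin ltr_pM2r ?invr_gt0// ltr_nat ltnSn.
  by rewrite -EFinB -mulrBl -natr1 addrAC subrr add0r mul1r.
apply/seteqP; split => x /=; rewrite !in_itv/=.
  move=> [<- /andP[x0 x1]]; have : 0 <= (2 ^ N)%:R * x by rewrite mulr_ge0// ltW.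
  move=> /truncn_itv; rewrite -/(cell N x).
  by rewrite ler_pdivrMr// ltr_pdivlMr// mulrC.
move=> /andP[]; rewrite ler_pdivrMr// ltr_pdivlMr// mulrC => xi xi1; split.
  by apply: truncn_def; rewrite xi.
have x0 : 0 <= x by rewrite -(pmulr_rge0 _ p0) (le_trans _ xi).
rewrite x0/= -(ler_pM2l p0) mulr1 (le_trans (ltW xi1))// ler_nat//.
Qed.

Lemma lebesgue01_ae_itv : {ae mu, forall x : T, (x : R) \in `[0, 1[}.
Proof.
exists (~` `[0%R, 1%R[%classic); split => //=.
- by apply: measurableC; exact: measurable_itv.
- rewrite /lebesgue01/= /mrestr; apply/eqP; rewrite eq_le measure_ge0 andbT.
  rewrite -(@lebesgue_measure_set1 R 1); apply: le_measure; rewrite ?inE//=.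
    by apply: measurableI => //; apply: measurableC; exact: measurable_itv.
  move=> x /=; rewrite !in_itv/= => -[+ /andP[x0 x1]].
  by rewrite x0/= => /negP; rewrite -leNgt => x1'; apply/eqP; rewrite eq_le x1.
Qed.

(** Almost every point lies in one of the cells of index below [2^N], each of measure [1 / 2^N];
    integrals thereby become finite averages. *)
Lemma integral_cell N h : (forall i, 0 <= h i) ->
  (\int[mu]_x (h (cell N x))%:E = (mean N h)%:E)%E.
Proof.
move=> h0.
pose g i x : \bar R := ((h i)%:E * (\1_[set x | cell N x = i] x)%:E)%E.
have mi i : measurable [set x : T | cell N x = i].
  by rewrite (_ : [set _ | _] = cell N @^-1` [set i])//; exact: measurable_cell.
have mg i : measurable_fun setT (g i).
  by apply/measurable_EFinP; apply: measurable_funM => //; exact: measurable_indic.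
have g0 i x : (0 <= g i x)%E by rewrite mule_ge0// lee_fin.
transitivity (\int[mu]_x (\sum_(0 <= i < 2 ^ N) g i x))%E.
  apply: ge0_ae_eq_integral => //.
  - by apply/measurable_EFinP; exact: (measurable_fun_cell N h).
  - exact: emeasurable_sum.
  - by move=> x _; rewrite lee_fin.
  - by move=> x _; apply: sume_ge0.
  apply: filterS lebesgue01_ae_itv => x; rewrite in_itv/= => /andP[x0 x1] _.
  have cN : (cell N x < 2 ^ N)%N.
    rewrite /cell truncn_lt_nat; last by rewrite mulr_ge0.
    by rewrite gtr_pMr ?pow2_gt0.
  rewrite (bigD1_seq (cell N x)) ?iota_uniq ?mem_index_iota//=.
  rewrite big1 ?adde0 /g ?indicE ?mem_set ?mule1// => i /eqP ic.
  by rewrite indicE memNset ?mule0//= => ci; apply: ic.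
rewrite ge0_integral_sum// /mean mulr_suml -sumEFin; apply: eq_big_nat => i iN.
rewrite ge0_integralZl//; last first.
- by rewrite lee_fin.
- by apply/measurable_EFinP; exact: measurable_indic.
by rewrite integral_indic// setIT lebesgue01_cell.
Qed.

Definition osc n (x : T) : R := (-1) ^+ cell n.+1 x * amp n (cell n x).

Lemma measurable_osc n (D : set T) : measurable_fun D (osc n).
Proof.
apply: measurable_funM; first exact: (measurable_fun_cell _ (fun i => (-1) ^+ i)).
exact: measurable_fun_cell.
Qed.

Lemma amp_gt0 n I : 0 < amp n I :> R.
Proof. exact: spike_gt0. Qed.

Lemma normr_osc n x : `|osc n x| = amp n (cell n x).
Proof. by rewrite /osc normrM normrX normrN1 expr1n mul1r gtr0_norm// amp_gt0. Qed.

Lemma integral_osc n : (\int[mu]_x `|osc n x|%:E = 1)%E.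
Proof.
under eq_integral do rewrite normr_osc.
rewrite (@integral_cell n (amp n)); last by move=> i; exact/ltW/amp_gt0.
by rewrite (mean_amp n id) mean_spike.
Qed.

(* Over a full block, the cyclic shifts of the spike add up to a constant. *)
Lemma sum_block_osc L x :
  \sum_(0 <= i < 2 ^ L) `|osc (2 ^ L + i) x| = (2 ^ L)%:R.
Proof.
transitivity (\sum_(0 <= i < 2 ^ L) @spike R L ((i + (cell L x + 2 ^ L)) %% 2 ^ L)).
  apply: eq_big_nat => i /andP[_ iL]; rewrite normr_osc /amp.
  have lE : level (2 ^ L + i) = L.
    apply: trunc_log_eq => //; rewrite leq_addr/= expnS mul2n -addnn.
    by rewrite ltn_add2l.
  have LL : (L <= 2 ^ L + i)%N by rewrite -{1}lE; exact: level_le.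
  by rewrite lE -{1}(subnKC LL) cell_div; congr (spike L (_ %% _)); lia.
rewrite (sum_periodic (f := fun i => spike L (i %% 2 ^ L))); last first.
  by move=> i; rewrite modnDr.
rewrite -[RHS]mul1r -[X in X * _](@mean_spike R L) /mean divfK ?gt_eqF ?pow2_gt0//.
by apply: eq_big_nat => i /andP[_ iL]; rewrite modn_small.
Qed.

(** The ancestors of the cell of a point are its coarser cells. Through this, [mean_walk_sqr]
    becomes the L2 orthogonality of the signed increments. *)
Lemma walk_cell (w : nat -> nat -> R) N x :
  walk w N (cell N x) = \sum_(0 <= n < N) (-1) ^+ cell n.+1 x * w n (cell n x).
Proof.
elim: N => [|N IH]; first by rewrite big_geq.
by rewrite big_nat_recr//= cell_half IH.
Qed.

(* Bounds the weak-L1 norm of [osc n]. *)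
Definition weak_norm (n : nat) : R := (harm (2 ^ level n))^-1.

Lemma weak_norm_gt0 n : 0 < weak_norm n.
Proof. by rewrite invr_gt0 (lt_le_trans ltr01)// harm_ge1// expn_gt0. Qed.

Lemma weak_norm_nonincreasing m n : (m <= n)%N -> weak_norm n <= weak_norm m.
Proof.
move=> mn; have h k : 0 < harm (2 ^ k) :> R.
  by rewrite (lt_le_trans ltr01)// harm_ge1// expn_gt0.
rewrite lef_pV2 ?posrE//; apply: harm_nondecreasing.
by rewrite leq_exp2l//; exact: leq_trunc_log.
Qed.

Lemma weak_norm_small (e : R) : 0 < e -> exists n, weak_norm n <= e.
Proof.
(* The index [2^k] has level [k], where the harmonic sum is at least [k / 2 > 1 / e]. *)
move=> e0; pose k := (Num.truncn (2 / e)).+1; exists (2 ^ k)%N.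
rewrite /weak_norm /level trunc_expnK// -[leRHS]invrK lef_pV2 ?posrE ?invr_gt0//.
  apply: le_trans (harm_pow2_ge k); rewrite ler_pdivlMr// mulrC.
  exact/ltW/truncnS_gt.
by rewrite (lt_le_trans ltr01)// harm_ge1// expn_gt0.
Qed.

Lemma osc_tail n (s : R) : 0 < s ->
  (mu [set x | (s <= `|osc n x|)%R] <= (weak_norm n / s)%:E)%E.
Proof.
move=> s0; have m : measurable [set x : T | s <= `|osc n x|].
  rewrite (_ : [set _ | _] = cell n @^-1` [set i | s <= amp n i]).
    exact: measurable_cell.
  by apply/seteqP; split => x /=; rewrite normr_osc.
rewrite -[X in mu X]setIT -integral_indic//.
rewrite (eq_integral (fun x => ((s <= @amp R n (cell n x))%R%:R)%:E)); last first.
  move=> x _; rewrite indicE -normr_osc; congr ((nat_of_bool _)%:R)%:E.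
  by apply/idP/idP; rewrite inE.
rewrite (@integral_cell n (fun i => (s <= @amp R n i)%R%:R))// lee_fin.
rewrite (mean_amp n (fun y => (s <= y)%R%:R)); apply: le_trans (spike_ge_tail _ s0) _.
by rewrite invfM mulrC.
Qed.

End cells.

(** * The weak-type inequality for finite sums *)

Section weak_type.
Context {R : realType}.
Local Notation mu := (lebesgue01 R).
Local Notation T := (measurableTypeR R).
Implicit Types (d : nat -> R) (N P n : nat) (t : R).

(** Splitting at height [t]: an indicator for the estimate in measure, and a truncated coefficient,
    without its sign digit, to feed [walk]. *)
Let big d t n I : R := (t <= `|d n| * amp n I)%R%:R.
Let small d t n I : R := (`|d n| * amp n I < t)%R%:R * (d n * amp n I).

Let weak_normE n : weak_norm n = (harm (2 ^ level n))^-1 :> R. Proof. by []. Qed.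

Let mean_big d t n : 0 < t -> mean n (big d t n) <= `|d n| * weak_norm n / t.
Proof.
move=> t0; have [d0|dn] := eqVneq (d n) 0.
  rewrite d0 normr0 !mul0r /mean big1 ?mul0r// => i _.
  by rewrite /big d0 normr0 mul0r leNgt t0.
rewrite /big (mean_amp n (fun y => (t <= `|d n| * y)%R%:R)).
have s0 : 0 < t / `|d n| by rewrite divr_gt0 ?normr_gt0.
have -> : `|d n| * weak_norm n / t = (t / `|d n| * harm (2 ^ level n))^-1.
  by rewrite weak_normE !invfM invrK; ring.
apply: le_trans (spike_ge_tail (level n) s0); apply: le_mean => i _.
by rewrite ler_pdivrMr ?normr_gt0// mulrC.
Qed.

Let mean_small d t n : 0 < t ->
  mean n (fun I => small d t n I ^+ 2) <= 2 * t * `|d n| * weak_norm n.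
Proof.
move=> t0; have [d0|dn] := eqVneq (d n) 0.
  rewrite d0 normr0 mulr0 mul0r /mean big1 ?mul0r// => i _.
  by rewrite /small d0 mul0r mulr0 expr0n.
rewrite /small (mean_amp n (fun y => ((`|d n| * y < t)%R%:R * (d n * y)) ^+ 2)).
have s0 : 0 < t / `|d n| by rewrite divr_gt0 ?normr_gt0.
have /(ler_wpM2l (sqr_ge0 (d n))) := spike_truncated_sqr (level n) s0.
rewrite -meanZ -weak_normE.
have -> : d n ^+ 2 * (2 * (t / `|d n|) * weak_norm n) = 2 * t * `|d n| * weak_norm n.
  by rewrite -[d n ^+ 2]real_normK ?num_real//; field; rewrite normr_eq0.
apply: le_trans; apply: le_mean => i _.
rewrite ltr_pdivlMr ?normr_gt0// [spike _ _ * `|_|]mulrC exprMn.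
by rewrite exprMn mulrCA; case: (_ < t); rewrite ?expr1n// expr0n.
Qed.

(* The terms exceeding t are discarded, each on a set of measure at most
   |d n| * weak_norm n / t, and the rest is estimated in L2 by orthogonality. *)
Lemma weak_type d N P t (M : R) : 0 < t ->
  (forall n, (n < N)%N -> d n = 0) -> \sum_(0 <= n < P) `|d n| <= M ->
  (mu [set x : T | (t <= `|\sum_(0 <= n < P) d n * osc n x|)%R] <=
   (3 * M * weak_norm N / t)%:E)%E.
Proof.
move=> t0 dN dM; set A := [set x | _].
pose b n (x : T) : \bar R := (big d t n (cell n x))%:E.
pose s (x : T) : \bar R := (t^-2 * walk (small d t) P (cell P x) ^+ 2)%:E.
have mb n : measurable_fun setT (b n).
  by apply/measurable_EFinP; exact: (measurable_fun_cell _ (big d t n)).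
have ms : measurable_fun setT s.
  apply/measurable_EFinP.
  exact: (measurable_fun_cell _ (fun I => t^-2 * walk (small d t) P I ^+ 2)).
have b0 n x : (0 <= b n x)%E by rewrite lee_fin.
have s0 x : (0 <= s x)%E by rewrite lee_fin mulr_ge0 ?sqr_ge0// invr_ge0 sqr_ge0.
have mA : measurable A.
  apply: measurable_ge; apply: measurable_sum => n.
  by apply: measurable_funM => //; exact: measurable_osc.
(* The indicator of [A] is majorized pointwise: either some term reaches [t] and its [b n] is 1, or
   nothing is truncated and the sum is the walk, whose square is at least [t^2]. *)
apply: (@le_trans _ _ (\int[mu]_x (\sum_(0 <= n < P) b n x + s x)))%E.
  rewrite -[X in mu X]setIT -integral_indic//; apply: ge0_le_integral => //.
  - by apply/measurable_EFinP; exact: measurable_indic.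
  - by apply: emeasurable_funD => //; exact: emeasurable_sum.
  - move=> x _; rewrite indicE sumEFin -EFinD lee_fin.
    have [/set_mem Ax|_] := boolP (x \in A); last first.
      rewrite addr_ge0 ?sumr_ge0//; have := s0 x; rewrite lee_fin//.
    have [big1|] := pselect (exists2 n, (n < P)%N & t <= `|d n| * amp n (cell n x)).
      have [n nP tn] := big1; apply: ler_wpDr; first by have := s0 x; rewrite lee_fin.
      rewrite (bigD1_seq n) ?iota_uniq ?mem_index_iota//= /big tn lerDl.
      by apply: sumr_ge0.
    move=> nbig; apply: ler_wpDl; first by apply: sumr_ge0.
    rewrite mulrC ler_pdivlMr ?exprn_gt0// mul1r walk_cell.
    rewrite -[leRHS]real_normK ?num_real// lerXn2r ?nnegrE ?(ltW t0)//.
    move: Ax; rewrite /A/= => /le_trans; apply.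
    rewrite le_eqVlt; apply/orP; left; apply/eqP.
    congr `|_|; apply: eq_big_nat => n /andP[_ nP]; rewrite /small.
    rewrite ltNge; case: leP => [tn|_]; last by rewrite /osc mul1r mulrCA.
    by exfalso; apply: nbig; exists n.
rewrite ge0_integralD//; last 2 first.
- by move=> x _; apply: sume_ge0.
- exact: emeasurable_sum.
rewrite ge0_integral_sum//.
rewrite (@integral_cell _ _ (fun I => t^-2 * walk (small d t) P I ^+ 2)); last first.
  by move=> i; rewrite mulr_ge0 ?sqr_ge0// invr_ge0 sqr_ge0.
under eq_bigr do rewrite (@integral_cell _ _ (big d t _))//.
rewrite sumEFin -EFinD lee_fin meanZ mean_walk_sqr mulr_sumr -big_split/=.
have -> : 3 * M * weak_norm N / t = M * (3 * weak_norm N / t) by ring.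
apply: le_trans (ler_wpM2r _ dM); last first.
  by rewrite divr_ge0 ?ltW// mulr_gt0 ?weak_norm_gt0.
rewrite mulr_suml; apply: ler_sum => n _.
(* The constant 3 is 1 from the large terms plus 2 from the truncated second moment. *)
apply: (@le_trans _ _ (`|d n| * weak_norm n / t + t^-2 * (2 * t * `|d n| * weak_norm n))).
  by rewrite lerD ?mean_big// ler_wpM2l ?mean_small// invr_ge0 sqr_ge0.
have -> : `|d n| * weak_norm n / t + t ^- 2 * (2 * t * `|d n| * weak_norm n) =
  `|d n| * (3 * weak_norm n / t) by field; rewrite gt_eqF.
have [nN|Nn] := ltnP n N; first by rewrite dN// normr0 !mul0r.
apply: ler_wpM2l => //; apply: ler_wpM2r; first by rewrite invr_ge0 ltW.
apply: ler_wpM2l => //; exact: weak_norm_nonincreasing.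
Qed.

End weak_type.

(** * Absolutely summable combinations *)

Section oscillating_series.
Context {R : realType}.
Local Notation mu := (lebesgue01 R).
Local Notation T := (measurableTypeR R).
Implicit Types (a b : nat -> R) (N P n : nat) (x : T) (M : R).

(** Stated through partial sums, the l1 bound is an intersection of closed conditions on finitely
    many coordinates, hence closed under pointwise convergence. *)
Definition l1_ball M : set (nat -> R) :=
  [set a | forall N, \sum_(0 <= n < N) `|a n| <= M].

Definition osc_psum a N x : R := \sum_(0 <= n < N) a n * osc n x.

(* limn_esup makes the sum total and measurable; off the null set where the
   series does not converge absolutely its value is irrelevant. *)
Definition osc_sum a x : R := fine (limn_esup (fun N => (osc_psum a N x)%:E)).

Definition osc_summable a x := (\sum_(0 <= n <oo) `|a n * osc n x|%:E < +oo)%E.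

Lemma measurable_osc_psum a N (D : set T) : measurable_fun D (osc_psum a N).
Proof.
apply: measurable_sum => n; apply: measurable_funM => //; exact: measurable_osc.
Qed.

Lemma measurable_osc_sum a (D : set T) : measurable_fun D (osc_sum a).
Proof.
apply: (@measurable_funS _ _ _ _ setT) => //.
apply: (measurableT_comp (@fine_measurable R _ measurableT)) => //.
apply: measurable_fun_limn_esup => N; apply/measurable_EFinP.
exact: measurable_osc_psum.
Qed.

Lemma osc_psumB a N P x : (P <= N)%N ->
  osc_psum a N x - osc_psum a P x = \sum_(P <= n < N) a n * osc n x.
Proof.
by move=> PN; rewrite /osc_psum (big_cat_nat (leq0n _) PN)/= addrAC subrr add0r.
Qed.

Lemma osc_psum_lim a x (l : R) :
  osc_psum a N x @[N --> \oo] --> l -> osc_sum a x = l.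
Proof.
move=> al; rewrite /osc_sum.
have /cvg_limn_einf_sup[_ ->] : (osc_psum a N x)%:E @[N --> \oo] --> l%:E.
  by apply: cvg_EFin => //; exact: nearW.
by [].
Qed.

Lemma osc_sum_cvg a x : osc_summable a x ->
  osc_psum a N x @[N --> \oo] --> osc_sum a x.
Proof.
move=> ax; suff : cvgn (fun N => osc_psum a N x).
  by move/cvg_ex => [l al]; rewrite (osc_psum_lim al).
apply: (@normed_cvg _ R^o); apply: nondecreasing_is_cvgn.
  by apply: nondecreasing_series => *; exact: normr_ge0.
have s0 n : (0 <= `|a n * osc n x|%:E)%E by [].
exists (fine (\sum_(0 <= n <oo) `|a n * osc n x|%:E)%E) => _ [N _ <-].
rewrite -lee_fin fineK; last first.
  by rewrite ge0_fin_numE//; exact: nneseries_ge0.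
rewrite /normed_series_of seriesEnat/= -sumEFin; exact: nneseries_lim_ge.
Qed.

Lemma osc_sum_tail a P x : osc_summable a x ->
  (`|osc_sum a x - osc_psum a P x|%:E <= \sum_(P <= n <oo) `|a n * osc n x|%:E)%E.
Proof.
move=> ax; have c : (`|osc_psum a N x - osc_psum a P x|%:E)%E @[N --> \oo] -->
    (`|osc_sum a x - osc_psum a P x|%:E)%E.
  apply: cvg_EFin; first by apply: nearW.
  by apply: cvg_norm; apply: cvgB; [exact: osc_sum_cvg|exact: cvg_cst].
rewrite -(cvg_lim _ c)//; apply: lime_le; first by apply/cvg_ex; eexists; exact: c.
near=> N; rewrite osc_psumB; last by near: N; exact: nbhs_infty_ge.
apply: (@le_trans _ _ (\sum_(P <= n < N) `|a n * osc n x|%:E)%E).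
  by rewrite sumEFin lee_fin; exact: ler_norm_sum.
exact: nneseries_lim_ge.
Unshelve. all: by end_near. Qed.

Lemma integral_oscM a n : (\int[mu]_x `|a n * osc n x|%:E = `|a n|%:E)%E.
Proof.
under eq_integral do rewrite normrM EFinM.
rewrite ge0_integralZl//.
- by rewrite integral_osc mule1.
- apply/measurable_EFinP; apply: measurableT_comp => //; exact: measurable_osc.
Qed.

Lemma measurable_oscM a n (D : set T) :
  measurable_fun D (fun x => `|a n * osc n x|%:E).
Proof.
apply/measurable_EFinP; apply: measurableT_comp => //.
by apply: measurable_funM => //; exact: measurable_osc.
Qed.

Lemma integral_osc_series a P :
  (\int[mu]_x (\sum_(P <= n <oo) `|a n * osc n x|%:E) =
   \sum_(P <= n <oo) `|a n|%:E)%E.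
Proof.
transitivity (\int[mu]_x (\sum_(0 <= n <oo) `|a (n + P)%N * osc (n + P) x|%:E))%E.
  apply: eq_integral => x _.
  by rewrite (nneseries_addn (f := fun n => `|a n * osc n x|%:E)).
rewrite integral_nneseries//; last first.
  by move=> n; exact: measurable_oscM.
rewrite -(nneseries_addn (f := fun n => `|a n|%:E))//; apply: eq_eseriesr => n _.
exact: integral_oscM.
Qed.

Lemma measurable_osc_series a P :
  measurable_fun setT (fun x => \sum_(P <= n <oo) `|a n * osc n x|%:E)%E.
Proof.
under eq_fun do rewrite -(nneseries_addn (f := fun n => `|a n * osc n _|%:E))//.
by apply: ge0_emeasurable_sum => // n _; exact: measurable_oscM.
Qed.

Lemma l1_ball_nneseries M a : l1_ball M a -> (\sum_(0 <= n <oo) `|a n|%:E <= M%:E)%E.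
Proof.
move=> aM; apply: lime_le; first exact: is_cvg_nneseries.
by apply: nearW => N; rewrite sumEFin lee_fin.
Qed.

(** Each [|osc n|] has integral 1, so the series of moduli has integral at most [M] and is finite
    almost everywhere. *)
Lemma ae_osc_summable M a : l1_ball M a -> {ae mu, forall x, osc_summable a x}.
Proof.
move=> aM; have : mu.-integrable setT (fun x => \sum_(0 <= n <oo) `|a n * osc n x|%:E)%E.
  apply/integrableP; split; first exact: measurable_osc_series.
  under eq_integral do rewrite gee0_abs ?nneseries_ge0//.
  by rewrite integral_osc_series (le_lt_trans (l1_ball_nneseries aM)) ?ltry.
move=> /integrable_ae => /(_ measurableT); apply: filterS => x /(_ I).
by rewrite ge0_fin_numE// nneseries_ge0.
Qed.

Lemma integral_osc_sum_tail M a P : l1_ball M a ->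
  (\int[mu]_x `|osc_sum a x - osc_psum a P x|%:E <= \sum_(P <= n <oo) `|a n|%:E)%E.
Proof.
move=> aM; rewrite -integral_osc_series; apply: ae_ge0_le_integral => //.
- apply/measurable_EFinP; apply: measurableT_comp => //.
  by apply: measurable_funB; [exact: measurable_osc_sum|exact: measurable_osc_psum].
- by move=> x _; exact: nneseries_ge0.
- exact: measurable_osc_series.
by apply: filterS (ae_osc_summable aM) => x ax _; exact: osc_sum_tail.
Qed.

Lemma integral_osc_psum a P :
  (\int[mu]_x `|osc_psum a P x|%:E <= (\sum_(0 <= n < P) `|a n|)%:E)%E.
Proof.
apply: (@le_trans _ _ (\int[mu]_x (\sum_(0 <= n < P) `|a n * osc n x|%:E))%E).
  apply: ge0_le_integral => //.
  - apply/measurable_EFinP; apply: measurableT_comp => //.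
    exact: measurable_osc_psum.
  - by apply: emeasurable_sum => n; exact: measurable_oscM.
  - by move=> x _; rewrite sumEFin lee_fin ler_norm_sum.
rewrite ge0_integral_sum//; last by move=> n; exact: measurable_oscM.
by under eq_bigr do rewrite integral_oscM; rewrite sumEFin.
Qed.

Lemma osc_sum_lincomb (s t : R) M a b : l1_ball M a -> l1_ball M b ->
  osc_sum (fun n => s * a n + t * b n) =
  (fun x => s * osc_sum a x + t * osc_sum b x) %[ae mu].
Proof.
move=> aM bM; apply: filterS2 (ae_osc_summable aM) (ae_osc_summable bM) => x ax bx _.
apply: osc_psum_lim.
rewrite (_ : (fun N => _) = fun N => s * osc_psum a N x + t * osc_psum b N x).
  by apply: cvgD; apply: cvgMr; exact: osc_sum_cvg.
apply/funext => N; rewrite /osc_psum !mulr_sumr -big_split/=.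
by apply: eq_bigr => n _; ring.
Qed.

End oscillating_series.

(** * The map from the l1 ball to L0 and its equicontinuity *)

Section embedding.
Context {R : realType}.
Local Notation mu := (lebesgue01 R).
Local Notation T := (measurableTypeR R).
Implicit Types (a b : nat -> R) (N P n : nat) (x : T) (M : R).

HB.instance Definition _ a :=
  isMeasurableFun.Build _ _ T R (osc_sum a) (@measurable_osc_sum R a setT).

Definition osc_class a : L0 mu := L0_of mu (osc_sum a).

Lemma osc_classE a : (osc_class a : T -> R) = osc_sum a %[ae mu].
Proof. exact: L0_ofE. Qed.

Lemma osc_class_lincomb (s t : R) M a b : l1_ball M a -> l1_ball M b ->
  osc_class (fun n => s * a n + t * b n) = s *: osc_class a + t *: osc_class b.
Proof.
move=> aM bM; apply/L0_eqP.
have /(filterI (osc_classE a)) h1 := osc_sum_lincomb s t aM bM.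
have /(filterI (osc_classE b)) h2 := osc_classE (fun n => s * a n + t * b n).
have /(filterI (L0_scaleE s (osc_class a))) h3 := L0_scaleE t (osc_class b).
have := L0_addE (s *: osc_class a) (t *: osc_class b).
move/(filterI h1); move: h2 h3; apply: filterS3 => x [h1' h2] [h3 h4] [[h5 h6] h7] xT.
by rewrite h2//= h6// h7//= h3//= h4//= h5// h1'.
Qed.

Lemma l1_ballN M a : l1_ball M a -> l1_ball M (fun n => - a n).
Proof. by move=> aM N; under eq_bigr do rewrite normrN; exact: aM. Qed.

Lemma l1_ball_tail M a (e : R) : l1_ball M a -> 0 < e ->
  \forall P \near \oo, (\sum_(P <= n <oo) `|a n|%:E <= e%:E)%E.
Proof.
move=> aM e0; have : (\sum_(P <= n <oo) `|a n|%:E)%E @[P --> \oo] --> 0%E.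
  apply: nneseries_tail_cvg => //.
  by apply: le_lt_trans (l1_ball_nneseries aM) _; rewrite ltry.
move/fine_cvgP => [fin] /cvgrPdist_le /(_ e e0); apply: filterS2 fin => P Pfin.
rewrite sub0r normrN /= => h; rewrite -(fineK Pfin) lee_fin.
by apply: le_trans h; exact: ler_norm.
Qed.

(* The finitely many coordinates below N contribute little in L1, and the
   others little in measure by the weak-type bound. *)
Lemma osc_class_equicontinuous (e : R) : 0 < e ->
  exists N, exists2 del : R, 0 < del & forall a b, l1_ball 1 a -> l1_ball 1 b ->
    (forall n, (n < N)%N -> `|a n - b n| < del) ->
    ball (osc_class a) e (osc_class b).
Proof.
(* At threshold [e / 2] and l1 bound 2, the weak-type estimate gives
   [6 (e^2 / 36) / (e / 2) = e / 3]. Markov's inequality with [2 eta = e^2 / 6] gives [e / 3] as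
   well. *)
move=> e0; have [N thinN] : exists N, weak_norm N <= e ^+ 2 / 36 :> R.
  by apply: weak_norm_small; rewrite divr_gt0 ?exprn_gt0.
pose eta := e ^+ 2 / 12; have eta0 : 0 < eta by rewrite divr_gt0 ?exprn_gt0.
(* The [N] low coordinates together contribute at most [eta]; [N + 1] keeps the quotient positive
   when [N = 0]. *)
exists N, (eta / N.+1%:R); first by rewrite divr_gt0.
move=> a b a1 b1 abN; pose d n := 1 * a n + (-1) * b n.
have dE n : d n = a n - b n by rewrite /d mul1r mulN1r.
have d2 : l1_ball 2 d.
  move=> P; apply: (@le_trans _ _ (\sum_(0 <= n < P) (`|a n| + `|b n|))).
    by apply: ler_sum => n _; rewrite dE ler_normB.
  by rewrite big_split/= -[2]/(1 + 1) lerD.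
have [P [NP tailP]] : exists P, (N <= P)%N /\
    (\sum_(P <= n <oo) `|d n|%:E <= eta%:E)%E.
  have : \forall P \near \oo, (N <= P)%N by exact: nbhs_infty_ge.
  move=> /(filterI (l1_ball_tail d2 eta0)) [P _ /(_ P)] /= [//|tP NP].
  by exists P.
pose d' n := if (n < N)%N then 0 else d n.
pose c n := if (n < N)%N then d n else 0.
have cd n : d n = c n + d' n.
  by rewrite /c /d'; case: ifP => _; rewrite ?addr0 ?add0r.
(* The weak-type bound is for finite sums, so only the part of [d'] below [P] is removed. What
   remains is the head [c] and the tail from [P] on, each of L1 norm at most [eta]. *)
pose g x := osc_sum d x - osc_psum d' P x.
have mg : measurable_fun setT g.
  by apply: measurable_funB; [exact: measurable_osc_sum|exact: measurable_osc_psum].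
have intg : (\int[mu]_x `|g x|%:E <= (2 * eta)%:E)%E.
  apply: (@le_trans _ _ (\int[mu]_x (`|osc_sum d x - osc_psum d P x|%:E +
      `|osc_psum c P x|%:E)))%E.
    apply: ge0_le_integral => //.
    - by apply/measurable_EFinP; exact: measurableT_comp.
    - apply: emeasurable_funD; apply/measurable_EFinP; apply: measurableT_comp => //.
        by apply: measurable_funB; [exact: measurable_osc_sum|exact: measurable_osc_psum].
      exact: measurable_osc_psum.
    - move=> x _; rewrite -EFinD lee_fin /g.
      have -> : osc_psum d' P x = osc_psum d P x - osc_psum c P x.
        rewrite /osc_psum -sumrB; apply: eq_bigr => n _; rewrite cd; ring.
      by rewrite opprB addrA addrAC; exact: ler_normD.
  rewrite ge0_integralD//; last 2 first.
  - apply/measurable_EFinP; apply: measurableT_comp => //.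
    by apply: measurable_funB; [exact: measurable_osc_sum|exact: measurable_osc_psum].
  - apply/measurable_EFinP; apply: measurableT_comp => //.
    exact: measurable_osc_psum.
  have -> : 2 * eta = eta + eta by ring.
  rewrite EFinD leeD//; first exact: le_trans (integral_osc_sum_tail P d2) _.
  apply: le_trans (integral_osc_psum _ _) _; rewrite lee_fin.
  rewrite (big_cat_nat (leq0n _) NP)/= [X in _ + X]big_nat_cond.
  rewrite [X in _ + X]big1 ?addr0; last first.
    by move=> n; rewrite andbT /c => /andP[Nn _]; rewrite ltnNge Nn normr0.
  apply: (@le_trans _ _ (\sum_(0 <= n < N) eta / N.+1%:R)).
    apply: ler_sum_nat => n /andP[_ nN]; rewrite /c nN dE; exact/ltW/abN.
  rewrite sumr_const_nat subn0 -[leLHS]mulr_natr -mulrA ger_pMr// mulrC ler_pdivrMr//.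
  by rewrite mul1r ler_nat.
have e20 : 0 < e / 2 by rewrite divr_gt0.
have weak := weak_type (d := d') (N := N) (P := P) (t := e / 2) (M := 2) e20.
pose A1 := [set x : T | e / 2 <= `|osc_psum d' P x|].
pose A2 := [set x : T | e / 2 <= `|g x|].
have mA1 : measurable A1 by apply: measurable_ge; exact: measurable_osc_psum.
have mA2 : measurable A2 by exact: measurable_ge.
apply: (@le_lt_trans _ _ (mu (A1 `|` A2))).
  apply: ae_le_measure; [exact/measurable_ge/measurable_L0B|exact: measurableU|].
  have := osc_sum_lincomb 1 (-1) a1 b1.
  move: (osc_classE a) (osc_classE b); apply: filterS3 => x ha hb hd.
  rewrite /= ha// hb// => ex.
  have [|lt1] := leP (e / 2) `|osc_psum d' P x|; first by left.
  right; rewrite /A2/= leNgt; apply/negP => lt2; move: ex; rewrite leNgt => /negP; apply.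
  have -> : osc_sum a x - osc_sum b x = g x + osc_psum d' P x.
    by rewrite /g subrK [RHS]hd// mul1r mulN1r.
  by apply: le_lt_trans (ler_normD _ _) _; rewrite [e]splitr ltrD.
apply: le_lt_trans (measureU2 _ mA1 mA2) _.
apply: (@le_lt_trans _ _ ((e / 3)%:E + (e / 3)%:E)%E); last first.
  by rewrite -EFinD lte_fin; lra.
apply: leeD.
  apply: le_trans (weak _ _) _.
  - by move=> n nN; rewrite /d' nN.
  - apply: le_trans (d2 P); apply: ler_sum => n _; rewrite /d'.
    by case: ifP => // _; rewrite normr0.
  rewrite lee_fin ler_pdivrMr//; apply: le_trans (ler_wpM2l _ thinN) _ => //.
  by rewrite le_eqVlt; apply/orP; left; apply/eqP; field.
apply: le_trans (markov_ineq mu e20 mg) _.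
rewrite lee_pdivrMl//; apply: le_trans intg _; rewrite -EFinM lee_fin /eta.
by rewrite le_eqVlt; apply/orP; left; apply/eqP; field.
Qed.

End embedding.

(** * Equicontinuous images of compact sets of sequences *)

Lemma sum_norm_continuous {R : realType} (Z : topologicalType)
    (f : nat -> Z -> R) N : (forall n, continuous (f n)) ->
  continuous (fun z => \sum_(0 <= n < N) `|f n z|).
Proof.
move=> cf z; elim: N => [|N IH].
  rewrite (_ : (fun _ => _) = cst 0); first exact: cst_continuous.
  by apply/funext => b; rewrite big_geq.
rewrite (_ : (fun _ => _) =
    (fun y => \sum_(0 <= n < N) `|f n y| + `|f N y|)); last first.
  by apply/funext => y; rewrite big_nat_recr.
by apply: cvgD; [exact: IH|apply: cvg_norm; exact: cf].
Qed.

Section pointwise_topology.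
Context {R : realType}.
Local Notation X := {ptws nat -> R}.

Lemma ptws_coord_continuous n : continuous (fun a : X => a n).
Proof. exact: (@proj_continuous nat (fun=> R) n). Qed.

Lemma open_cylinder (a : X) N (del : R) :
  open [set b : X | forall n, (n < N)%N -> `|b n - a n| < del].
Proof.
elim: N => [|N IH].
  by rewrite (_ : [set _ | _] = setT); [exact: openT|apply/seteqP; split].
rewrite (_ : [set _ | _] = [set b : X | forall n, (n < N)%N -> `|b n - a n| < del]
    `&` (fun b : X => b N) @^-1` [set y | `|y - a N| < del]); last first.
  apply/seteqP; split => [b h|b [h1 h2] n]; last first.
    by rewrite ltnS leq_eqVlt => /orP[/eqP ->//|]; exact: h1.
  by split => [n nN|]; apply: h => //; exact: leqW.
apply: openI => //; apply: open_comp; first by move=> b _; exact: ptws_coord_continuous.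
apply: (@open_comp R R (fun y => `|y - a N|) [set y | y < del]); last exact: open_lt.
by move=> y _; apply: cvg_norm; apply: cvgB; [exact: cvg_id|exact: cvg_cst].
Qed.

(** A closed subset of a product of segments [[-M, M]], which is compact by Tychonoff's theorem. *)
Lemma compact_l1_ball (M : R) : compact (l1_ball M : set X).
Proof.
apply: (@subclosed_compact _ _ [set a : X | forall n, `[- M, M]%classic (a n)]).
- rewrite (_ : l1_ball M = \bigcap_N
      [set a : X | \sum_(0 <= n < N) `|a n| <= M]); last first.
    by apply/seteqP; split => a h N; [move=> _|]; exact: h.
  apply: closed_bigI => N _.
  apply: (@closed_comp X R (fun a : X => \sum_(0 <= n < N) `|a n|) [set y | y <= M]).
    move=> a _.
    exact: (@sum_norm_continuous R X (fun n b => b n) N ptws_coord_continuous a).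
  exact: closed_le.
- apply: (@tychonoff nat (fun=> R) (fun=> `[- M, M]%classic)) => n.
  exact: segment_compact.
move=> a aM n /=; rewrite in_itv/= -ler_norml; apply: le_trans (aM n.+1).
by rewrite big_nat_recr//= lerDr sumr_ge0.
Qed.

End pointwise_topology.

Section compact_image.
Context {R : realType} (Y : pseudoMetricType R) (E : (nat -> R) -> Y).
Variable B : set (nat -> R).
Local Notation X := {ptws nat -> R}.
Hypothesis cB : compact (B : set X).
Hypothesis E_equicontinuous : forall e : R, 0 < e ->
  exists N, exists2 del : R, 0 < del & forall a b, B a -> B b ->
    (forall n, (n < N)%N -> `|a n - b n| < del) -> ball (E a) e (E b).

Lemma within_equicontinuous : {within (B : set X), continuous (E : X -> Y)}.
Proof.
apply/subspace_continuousP => a Ba U /nbhs_ballP[e /= e0 eU].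
have [N [del del0 h]] := E_equicontinuous e0.
rewrite /nbhs/=.
have : nbhs (a : X) [set b : X | forall n, (n < N)%N -> `|b n - a n| < del].
  apply: open_nbhs_nbhs; split; first exact: open_cylinder.
  by move=> n _; rewrite subrr normr0.
apply: filterS => b ab Bb; apply/eU/h => // n nN.
by rewrite distrC; exact: ab.
Qed.

Lemma compact_equicontinuous_image : compact (E @` B).
Proof. exact: (continuous_compact within_equicontinuous cB). Qed.

(* Points of the image close to y have their preimages close to the fibre over
   y: the complement of a cylindrical neighbourhood of the fibre is compact, so
   its image is closed, and it misses y. *)
Lemma nbhs_cylinder_image (y : Y) N (del : R) : hausdorff_space Y -> 0 < del ->
  within (E @` B) (nbhs y) (E @` [set b | B b /\ exists a,
    [/\ B a, E a = y & forall n, (n < N)%N -> `|b n - a n| < del]]).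
Proof.
move=> hY del0; set V : set X := [set b | exists a,
  [/\ B a, E a = y & forall n, (n < N)%N -> `|b n - a n| < del]].
have oV : open V.
  rewrite (_ : V = \bigcup_(a in [set a | B a /\ E a = y])
      [set b : X | forall n, (n < N)%N -> `|b n - a n| < del]).
    by apply: bigcup_open => a _; exact: open_cylinder.
  by apply/seteqP; split => [b [a [Ba Ea h]]|b [a [Ba Ea] h]]; exists a.
have cE : closed (E @` (B `&` ~` V)).
  apply: compact_closed => //; apply: (@continuous_compact X Y E).
    apply: continuous_subspaceW within_equicontinuous; exact: subIsetl.
  apply: subclosed_compact cB _; last exact: subIsetl.
  apply: closedI; last exact: open_closedC.
  apply: compact_closed cB; exact: (hausdorff_product (fun=> @Rhausdorff R)).
have : nbhs y (~` (E @` (B `&` ~` V))).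
  apply: open_nbhs_nbhs; split; first exact: closed_openC.
  move=> [a [Ba nVa] Ea]; apply: nVa; exists a; split => // n _.
  by rewrite subrr normr0.
apply: filterS => z nz [b Bb Ebz]; exists b => //; split => //.
by apply: contrapT => nVb; apply: nz; exists b.
Qed.

End compact_image.

(** * The counterexample *)

Section counterexample.
Context {R : realType}.
Local Notation mu := (lebesgue01 R).
Local Notation T := (measurableTypeR R).
Implicit Types (a b : nat -> R) (N P n : nat) (x : T) (M : R).

Definition osc_body : set (L0 mu) := @osc_class R @` l1_ball 1.

Lemma l1_ball_conv a b (s : R) : 0 <= s -> s <= 1 -> l1_ball 1 a -> l1_ball 1 b ->
  l1_ball 1 (fun n => s * a n + (1 - s) * b n).
Proof.
move=> s0 s1 a1 b1 N; have s1' : 0 <= 1 - s by rewrite subr_ge0.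
apply: (@le_trans _ _ (\sum_(0 <= n < N) (s * `|a n| + (1 - s) * `|b n|))).
  apply: ler_sum => n _; apply: le_trans (ler_normD _ _) _.
  by rewrite !normrM (ger0_norm s0) (ger0_norm s1').
rewrite big_split/= -!mulr_sumr.
have := ler_wpM2l s0 (a1 N); have := ler_wpM2l s1' (b1 N); lra.
Qed.

Lemma convex_osc_image (A : set (nat -> R)) : A `<=` l1_ball 1 ->
  (forall a b (s : R), 0 <= s -> s <= 1 -> A a -> A b ->
    A (fun n => s * a n + (1 - s) * b n)) ->
  convex (@osc_class R @` A).
Proof.
move=> A1 cA X Y l /set_mem[a Aa <-] /set_mem[b Ab <-]; apply: mem_set.
exists (fun n => l%:inum * a n + (1 - l%:inum) * b n); first exact: cA.
by rewrite (osc_class_lincomb _ _ (A1 _ Aa) (A1 _ Ab)).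
Qed.

Lemma L1_bounded_osc_body : L1_bounded osc_body.
Proof.
have n1 X : osc_body X -> ('N[mu]_1[EFin \o X] <= 1%:E)%E.
  move=> [a a1 <-]; rewrite Lnorm1.
  rewrite (_ : (\int[mu]_x _ = \int[mu]_x `|osc_sum a x|%:E)%E); last first.
    apply: ge0_ae_eq_integral => //.
    - by apply: measurableT_comp => //; exact/measurable_EFinP.
    - by apply/measurable_EFinP; apply: measurableT_comp => //; exact: measurable_osc_sum.
    - by apply: filterS (osc_classE a) => x h _ /=; rewrite h.
  (* At [P = 0] the partial sum is empty, and the tail estimate bounds the whole norm. *)
  have := integral_osc_sum_tail 0 a1.
  under eq_integral do rewrite /osc_psum big_geq// subr0.
  by move=> /le_trans; apply; exact: l1_ball_nneseries.
split; last by exists 1.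
move=> X /n1 h.
have fX : finite_norm mu 1 (X : L0 mu) by apply: le_lt_trans h _; exact: ltry.
by exists (HB.pack_for (LspaceType mu (lexx 1%E)) X
  (@isFinLebesgue.Build _ _ _ mu 1%E (lexx 1%E) X fX)).
Qed.

Lemma l1_ball0 : l1_ball 1 (fun=> 0 : R).
Proof. by move=> N; rewrite big1// => n _; rewrite normr0. Qed.

Lemma circled_osc_body : circled osc_body.
Proof.
have N a : l1_ball 1 a -> osc_class (fun n => - a n) = - osc_class a.
  move=> a1; have := osc_class_lincomb (-1) 0 a1 l1_ball0.
  rewrite scale0r addr0 scaleN1r => <-; congr osc_class.
  by apply/funext => n; rewrite mulr0 addr0 mulN1r.
apply/seteqP; split => [_ [a a1 <-]|_ [_ [a a1 <-] <-]].
  exists (- osc_class a); last by rewrite opprK.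
  by exists (fun n => - a n); [exact: l1_ballN|exact: N].
by exists (fun n => - a n); [exact: l1_ballN|exact: N].
Qed.

Lemma compact_osc_body : compact osc_body.
Proof.
exact: (compact_equicontinuous_image (@compact_l1_ball R 1)
  (@osc_class_equicontinuous R)).
Qed.

(** Transports closeness to [X] to the origin, where [locally_convex_at] takes its neighborhoods. *)
Lemma L0_ballB (X Y : L0 mu) (e : R) : ball X e Y -> ball (0 : L0 mu) e (Y - X).
Proof.
apply: le_lt_trans; apply: ae_le_measure.
- exact/measurable_ge/measurable_L0B.
- exact/measurable_ge/measurable_L0B.
have := L0_addE Y (- X); move: (L0_oppE X) (L0_0E mu).
apply: filterS3 => x hX h0 hD /=.
by rewrite h0// hD//= hX//= sub0r normrN distrC.
Qed.

(** The witness is the image of a cylinder around the whole fibre over [X]. Linearity makes the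
    fibre, the cylinder and its image convex; [nbhs_cylinder_image] makes the image a relative
    neighborhood, and equicontinuity keeps it within [e] of [X]. *)
Lemma locally_convex_osc_body : locally_convex_on osc_body.
Proof.
move=> X KX U /nbhs_ballP[e /= e0 eU].
have [N [del del0 h]] := osc_class_equicontinuous e0.
set V := [set b | l1_ball 1 b /\ exists a,
  [/\ l1_ball 1 a, osc_class a = X & forall n, (n < N)%N -> `|b n - a n| < del]].
exists (@osc_class R @` V); split.
- apply: convex_osc_image => [b []//|b b' s s0 s1].
  move=> [b1 [a [a1 aX ab]]] [b'1 [a' [a'1 a'X ab']]]; split.
    exact: l1_ball_conv.
  exists (fun n => s * a n + (1 - s) * a' n); split.
  - exact: l1_ball_conv.
  - rewrite (osc_class_lincomb _ _ a1 a'1) aX a'X -scalerDl.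
    by rewrite addrC subrK scale1r.
  move=> n nN; have {}ab := ab _ nN; have {}ab' := ab' _ nN.
  rewrite (_ : _ - _ = s * (b n - a n) + (1 - s) * (b' n - a' n)); last by ring.
  have s1' : 0 <= 1 - s by rewrite subr_ge0.
  apply: le_lt_trans (ler_normD _ _) _.
  rewrite !normrM (ger0_norm s0) (ger0_norm s1').
  (* Strictness is drawn from the first term, which requires [s > 0]; at [s = 0] only the second
     term is left. *)
  have [->|s0'] := eqVneq s 0; first by rewrite mul0r add0r subr0 mul1r.
  have sp : 0 < s by rewrite lt_neqAle eq_sym s0'.
  have := ab; rewrite -(ltr_pM2l sp) => {}ab.
  have : (1 - s) * `|b' n - a' n| <= (1 - s) * del.
    by rewrite ler_wpM2l ?subr_ge0// ltW.
  lra.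
- exact: (nbhs_cylinder_image (@compact_l1_ball R 1)
    (@osc_class_equicontinuous R) X N (@L0_hausdorff _ _ _ mu) del0).
- move=> _ [b [b1 [a [a1 aX ab]]] <-]; split; last by exists b.
  exists (osc_class b - X); last by rewrite addrC subrK.
  apply: eU; apply: L0_ballB; rewrite -aX; apply: h => // n nN.
  by rewrite distrC; exact: ab.
Qed.

(** * Disagreement of the topologies under every equivalent probability *)

Definition unit_coef n : nat -> R := fun k => (k == n)%:R.

Lemma l1_ball_unit n : l1_ball 1 (unit_coef n).
Proof.
move=> N; have [nN|Nn] := ltnP n N.
  rewrite (bigD1_seq n) ?iota_uniq ?mem_index_iota//= big1 ?addr0.
    by rewrite /unit_coef eqxx normr1.
  by move=> k /negbTE kn; rewrite /unit_coef kn normr0.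
rewrite big_nat_cond big1// => k; rewrite andbT => /andP[_ kN].
by rewrite /unit_coef ltn_eqF ?normr0// (leq_trans kN).
Qed.

Lemma osc_sum_unit n x : osc_sum (unit_coef n) x = osc n x.
Proof.
apply: osc_psum_lim; apply: cvg_near_cst; exists n.+1 => // N /= nN.
rewrite /osc_psum (bigD1_seq n) ?iota_uniq ?mem_index_iota//= big1 ?addr0.
  by rewrite /unit_coef eqxx mul1r.
by move=> k /negbTE kn; rewrite /unit_coef kn mul0r.
Qed.

Lemma osc_sum0 x : osc_sum (fun=> 0) x = 0.
Proof.
apply: osc_psum_lim; apply: cvg_near_cst; apply: nearW => N.
by rewrite /osc_psum big1// => n _; rewrite mul0r.
Qed.

(** By [sum_block_osc], valid at every point of the line, the [2^L] integrals of a block add up to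
    [2^L]; they cannot all be at most [1/2]. *)
Lemma exists_large_integral_osc (Q : probability T R) L :
  exists2 n, (2 ^ L <= n)%N & (2^-1%:E < \int[Q]_x `|osc n x|%:E)%E.
Proof.
apply: contrapT => small.
have : (\sum_(0 <= i < 2 ^ L) \int[Q]_x `|osc (2 ^ L + i) x|%:E <=
    \sum_(0 <= i < 2 ^ L) 2^-1%:E)%E.
  apply: lee_sum => i _; rewrite leNgt; apply/negP => h; apply: small.
  by exists (2 ^ L + i)%N => //; exact: leq_addr.
rewrite -ge0_integral_sum//; last first.
  move=> i; apply/measurable_EFinP; apply: measurableT_comp => //.
  exact: measurable_osc.
under eq_integral do rewrite sumEFin sum_block_osc.
rewrite integral_cst// [X in (_ * X)%E]probability_setT mule1 sumEFin lee_fin.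
rewrite sumr_const_nat subn0 -[leRHS]mulr_natl leNgt => /negP; apply.
by rewrite gtr_pMr ?pow2_gt0// invf_lt1 ?ltr1n.
Qed.

(** An L0-open set with the same trace as a neighborhood of 0 inside the L1-ball of radius [1/2]
    would contain some [osc n] of L1 norm above [1/2]. *)
Lemma osc_body_disagree (Q : probability T R) : equivalent Q mu ->
  ~ L0_L1_topologies_agree (L0_cast Q @` osc_body).
Proof.
move=> [Qmu muQ] [sub agree].
have castE a : (L0_cast Q (osc_class a) : T -> R) = osc_sum a %[ae Q].
  apply: ae_eq_trans (L0_ofE Q _) _.
  exact: (null_dominates_ae_eq _ Qmu (osc_classE a)).
have K0 : (L0_cast Q @` osc_body) (L0_cast Q (osc_class (fun=> 0))).
  by exists (osc_class (fun=> 0)) => //; exists (fun=> 0) => //; exact: l1_ball0.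
have [g0 _ g0E] := sub _ K0.
pose V : set (L1 Q) := (ball g0 (2^-1 : R))°.
have oV : open V by exact: open_interior.
have Vg0 : V g0 by apply: nbhs_singleton; apply: nbhs_interior; exact: nbhsx_ballx.
have [_ /(_ (ex_intro2 _ _ V oV erefl))[U oU UV]] :=
  agree ((@L1_to_L0 _ _ _ Q @` V) `&` (L0_cast Q @` osc_body)).
have Ug0 : U (L0_cast Q (osc_class (fun=> 0))).
  suff [] : (U `&` (L0_cast Q @` osc_body)) (L0_cast Q (osc_class (fun=> 0))) by [].
  by rewrite -UV; split => //; exists g0.
have /nbhs_ballP[e /= e0 eU] : nbhs (L0_cast Q (osc_class (fun=> 0))) U.
  exact: open_nbhs_nbhs.
have [del del0 Qsmall] := finite_measure_continuous Qmu e0.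
(* Via [osc_tail] at height [e], this yields Lebesgue measure at most [del / 2], strictly below
   [del]. *)
have [L thinL] : exists L, weak_norm L <= e * del / 2.
  by apply: weak_norm_small; rewrite divr_gt0// mulr_gt0.
have [n Ln intn] := exists_large_integral_osc Q L.
pose Y := L0_cast Q (osc_class (unit_coef n)).
have KY : (L0_cast Q @` osc_body) Y.
  exists (osc_class (unit_coef n)) => //; exists (unit_coef n) => //.
  exact: l1_ball_unit.
have YE : (Y : T -> R) = osc n %[ae Q].
  by apply: filterS (castE (unit_coef n)) => x h xT; rewrite h// osc_sum_unit.
have zE : (L0_cast Q (osc_class (fun=> 0)) : T -> R) = cst 0 %[ae Q].
  by apply: filterS (castE (fun=> 0)) => x h xT; rewrite h// osc_sum0.
have UY : U Y.
  apply: eU; apply: (@le_lt_trans _ _ (Q [set x | e <= `|osc n x|])).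
    apply: ae_le_measure.
    - exact/measurable_ge/measurable_L0B.
    - by apply: measurable_ge; exact: measurable_osc.
    move: YE zE; apply: filterS2 => x h1 h2 /=.
    by rewrite h1// h2//= sub0r normrN.
  apply: Qsmall; first by apply: measurable_ge; exact: measurable_osc.
  apply: le_lt_trans (osc_tail _ e0) _; rewrite lte_fin ltr_pdivrMr//.
  (* Here [L] serves as an index rather than a level; monotonicity applies because
     [n >= 2^L > L]. *)
  have : weak_norm n <= weak_norm L :> R.
    by apply: weak_norm_nonincreasing; apply: leq_trans Ln; exact/ltnW/ltn_expl.
  have : 0 < e * del by rewrite mulr_gt0.
  lra.
have [[g Vg gY] _] : ((@L1_to_L0 _ _ _ Q @` V) `&` (L0_cast Q @` osc_body)) Y.
  by rewrite UV.
have : ball g0 (2^-1 : R) g by exact: interior_subset Vg.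
rewrite /ball/= /L1_ball Lnorm1 ltNge => /negP; apply.
apply: le_trans (ltW intn) _; apply: ae_ge0_le_integral => //.
- apply/measurable_EFinP; apply: measurableT_comp => //; exact: measurable_osc.
- apply: measurableT_comp => //; apply/measurable_EFinP.
  exact: (measurable_L0B (g0 : L0 Q) (g : L0 Q)).
move: YE zE; rewrite -gY -g0E; apply: filterS2 => x h1 h2 _ /=.
by rewrite h1// h2//= sub0r normrN.
Qed.

End counterexample.

Theorem theorem1p5 (R : realType) :
  exists K : set (L0 (lebesgue01 R)),
    [/\ convex K, L1_bounded K, circled K, compact K & locally_convex_on K] /\
    ~ exists Q : probability (measurableTypeR R) R,
        equivalent Q (lebesgue01 R) /\ L0_L1_topologies_agree (L0_cast Q @` K).
Proof.
exists (@osc_body R); split; last by move=> [Q [/osc_body_disagree]].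
split; [|exact: L1_bounded_osc_body|exact: circled_osc_body|
  exact: compact_osc_body|exact: locally_convex_osc_body].
by apply: convex_osc_image => //; exact: l1_ball_conv.
Qed.
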